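(* There exist bipartite planar graphs $G$ with minimum degree $\delta(G) = 2$ and $\overrightarrow{\chi}(G) = 4$.
   Context: All graphs are finite and simple, with at least one vertex. An orientation $\sigma$ of $G$ is a digraph obtained from $G$ by replacing each edge by exactly one of the two possible arcs with the same end-vertices. For $v \in V(G)$, the indegree $d^-_{\sigma}(v)$ is the number of arcs of $\sigma$ incoming to $v$. A $k$-orientation is an orientation in which every vertex has indegree at most $k$. An orientation $\sigma$ is proper if $d^-_{\sigma}(u) \ne d^-_{\sigma}(v)$ for every edge $uv \in E(G)$. The proper orientation number $\overrightarrow{\chi}(G)$ is the minimum integer $k$ such that $G$ admits a proper $k$-orientation. *)

(* Defs.v *)
(* MathComp and MathComp-Analysis *)
From HB Require Import structures.
From mathcomp Require Import all_boot all_order all_algebra.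
From mathcomp Require Import all_classical all_reals all_analysis.
Import Order.TTheory GRing.Theory Num.Theory.
Import numFieldNormedType.Exports.

Set Implicit Arguments.
Unset Strict Implicit.
Unset Printing Implicit Defensive.

Local Open Scope classical_set_scope.
Local Open Scope ring_scope.

Record sgraph := SGraph {
  vertex :> finType;
  adj : rel vertex;
  adj_sym : symmetric adj;
  adj_irrefl : irreflexive adj;
  vertex_gt0 : (0 < #|vertex|)%N
}.

Definition is_minimum (P : nat -> Prop) (k : nat) : Prop :=
  P k /\ forall j, P j -> (k <= j)%N.

Definition degree (G : sgraph) (v : G) : nat := #|[pred u | adj v u]|.

Definition is_min_degree (G : sgraph) (d : nat) : Prop :=
  is_minimum (fun j => exists v : G, degree v = j) d.

Definition bipartite (G : sgraph) : Prop :=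
  exists side : G -> bool, forall u v : G, adj u v -> side u != side v.

(* [o u v] means that the edge uv is replaced by the arc from u to v. *)
Definition orientation (G : sgraph) (o : rel G) : Prop :=
  (forall u v : G, o u v -> adj u v) /\
  (forall u v : G, adj u v -> o u v (+) o v u).

Definition indegree (G : sgraph) (o : rel G) (v : G) : nat :=
  #|[pred u | o u v]|.

Definition k_orientation (G : sgraph) (k : nat) (o : rel G) : Prop :=
  orientation o /\ forall v : G, (indegree o v <= k)%N.

Definition proper (G : sgraph) (o : rel G) : Prop :=
  forall u v : G, adj u v -> indegree o u <> indegree o v.

Definition is_proper_orientation_number (G : sgraph) (k : nat) : Prop :=
  is_minimum
    (fun j => exists o : rel G, k_orientation j o /\ proper o) k.

Definition is_arc (R : realType) (A : set (R * R)) (x y : R * R) : Prop :=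
  exists gamma : R -> R * R,
    [/\ {within `[0, 1], continuous gamma},
        {in `[0, 1] &, injective gamma},
        gamma 0 = x, gamma 1 = y &
        A = gamma @` `[0, 1]].

(* A plane drawing places the vertices at distinct points and draws each edge
   uv as an arc [A u v] between the points of u and v, whose interior contains
   no vertex and no point of another edge.  [A u v] and [A v u] are the same
   set, as they draw the same edge; [A] is irrelevant on nonadjacent pairs. *)
Definition plane_drawing (R : realType) (G : sgraph)
    (p : G -> R * R) (A : G -> G -> set (R * R)) : Prop :=
  [/\ injective p,
      forall u v : G, adj u v -> A u v = A v u,
      forall u v : G, adj u v -> is_arc (A u v) (p u) (p v),
      forall u v w : G, adj u v -> ~ (A u v `\` [set p u; p v]) (p w) &
      forall u v x y : G, adj u v -> adj x y ->
        [set u; v]%SET != [set x; y]%SET ->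
        (A u v `\` [set p u; p v]) `&` A x y = set0].

Definition planar (R : realType) (G : sgraph) : Prop :=
  exists (p : G -> R * R) (A : G -> G -> set (R * R)), plane_drawing p A.

(* Main.v *)
Require Import Defs.
From HB Require Import structures.
From mathcomp Require Import all_boot all_order all_algebra.
From mathcomp Require Import all_classical all_reals all_analysis.
From mathcomp Require Import ring lra ssrZ zify.
Import Order.TTheory GRing.Theory Num.Theory.
Import numFieldNormedType.Exports.

Set Implicit Arguments.
Unset Strict Implicit.
Unset Printing Implicit Defensive.

(** The graph has four hubs [Hub s t] forming the 4-cycle in which the two hubs
    with [s = false] are joined to the two hubs with [s = true], so that the
    hubs with the same [s] are opposite on the cycle.  For each [s] there are
    seven copies of a gadget hanging on the opposite hubs [Hub s false] and
    [Hub s true]: a vertex [Single] joined to both of them, two vertices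
    [Twin] joined to both of them, and a vertex [Link] joined to the twins.

    Suppose that there is a proper orientation with all indegrees at most 3.
    The two hubs of an opposite pair receive at most 6 arcs, so that one of
    their 7 gadgets sends them none ([untouched_copy]); in it, every single
    and every twin receives both its hub arcs.  The single has indegree 2, so
    no hub of the pair has indegree 2.  A twin has indegree 3 or 2 according
    to whether its link points to it; were both twins of indegree 2, the link
    would also have indegree 2 and conflict with them.  So some twin has
    indegree 3, and no hub of the pair has indegree 3.  Hence all four hubs
    have indegree at most 1 ([hub_indegree_le1]); as adjacent hubs differ, the
    four indegrees add up to at most 2, although the 4-cycle alone contributes
    4 arcs ([no_proper_3_orientation]).

    A proper 4-orientation makes the hubs with [s = false] sources and gives
    indegree 4 to the other two, which also receive the arcs from two of their
    singles ([orient]).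

    For planarity, one opposite pair is put on the horizontal axis and the
    other, farther from the origin, on the vertical one; the gadgets of the
    first pair are stacked on the vertical axis between its hubs, and those
    of the second pair in a row on the horizontal axis, outside the cycle
    ([position]).  With straight edges the drawing has no crossing, which
    reduces to signs of integer cross products ([noncrossingP],
    [edges_noncrossing]). *)

(** * Segments that do not cross *)

Section Cross.
Local Open Scope ring_scope.

(** Twice the signed area of the triangle [a b z]: its sign tells the side of
    the line [a b] on which [z] lies. *)
Definition cross (T : pzRingType) (a b z : T * T) : T :=
  (b.1 - a.1) * (z.2 - a.2) - (b.2 - a.2) * (z.1 - a.1).

(** A sufficient criterion, decided by signs, for the interior of the segment
    [a b] to avoid the segment [c d].  In the first two cases [a] and [b] lie
    weakly on one side of the line [c d] and are not both on it, which also
    covers two edges with a common end; in the last case [c] and [d] lie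
    strictly on one side of the line [a b]. *)
Definition noncrossing (T : numDomainType) (a b c d : T * T) : bool :=
  let s := cross c d a in let t := cross c d b in
  [|| [&& 0 <= s, 0 <= t & 0 < s + t],
      [&& s <= 0, t <= 0 & s + t < 0]
    | 0 < cross a b c * cross a b d].

(** Vertices are placed at points with binary integer coordinates, so that the
    criterion can be evaluated; this is the corresponding point of [T * T]. *)
Definition point (T : pzRingType) (q : BinNums.Z * BinNums.Z) : T * T :=
  ((int_of_Z q.1)%:~R, (int_of_Z q.2)%:~R).

Lemma cross_point (T : pzRingType) q r s :
  cross (point T q) (point T r) (point T s) = (int_of_Z (cross q r s))%:~R.
Proof. by rewrite /cross /point /= !(rmorphB, rmorphM). Qed.

Lemma int_of_Z_ge0 z : (0 <= int_of_Z z) = (0 <= z).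
Proof. by case: z. Qed.

Lemma int_of_Z_le0 z : (int_of_Z z <= 0) = (z <= 0).
Proof. by rewrite -oppr_ge0 -rmorphN int_of_Z_ge0 oppr_ge0. Qed.

Lemma noncrossing_point (T : numDomainType) a b c d :
  noncrossing (point T a) (point T b) (point T c) (point T d)
    = noncrossing a b c d.
Proof.
rewrite /noncrossing !cross_point -!intrM -!intrD -!rmorphM -!rmorphD /=.
by rewrite !(ler0z, lerz0, ltr0z, ltrz0) !ltNge !(int_of_Z_ge0, int_of_Z_le0).
Qed.

Lemma point_inj (T : numDomainType) : injective (@point T).
Proof.
move=> [a b] [c d] [] /intr_inj /(can_inj int_of_ZK) ->.
by move=> /intr_inj /(can_inj int_of_ZK) ->.
Qed.

End Cross.

Section Segment.
Local Open Scope classical_set_scope.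
Local Open Scope ring_scope.
Variable R : realType.
Implicit Types a b c d z : R * R.

Definition along a b (t : R) : R * R :=
  (a.1 + t * (b.1 - a.1), a.2 + t * (b.2 - a.2)).

Definition segment a b : set (R * R) := along a b @` `[0, 1].

Lemma segmentC a b : segment a b = segment b a.
Proof.
suff sub x y : segment x y `<=` segment y x by apply/seteqP; split; apply: sub.
move=> _ [t /= t01 <-]; exists (1 - t).
  by move: t01; rewrite /= !in_itv /=; lra.
by rewrite /along; congr pair; ring.
Qed.

Lemma segment_left a b : segment a b a.
Proof.
exists 0; first by rewrite /= in_itv /= lexx ler01.
by rewrite /along !mul0r !addr0 -surjective_pairing.
Qed.

Lemma is_arc_segment a b : a != b -> is_arc (segment a b) a b.
Proof.
move=> ab; exists (along a b); split=> //.
- apply: continuous_subspaceT => t.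
  have affine (x y r : R) : x + u * y @[u --> r] --> x + r * y.
    by apply: cvgD; [exact: cvg_cst|apply: cvgMr_tmp; exact: cvg_id].
  exact: (cvg_pair (affine a.1 (b.1 - a.1) t) (affine a.2 (b.2 - a.2) t)).
- move=> s t _ _ [/addrI e1 /addrI e2]; apply/eqP; rewrite -subr_eq0.
  apply: contraNT ab => st.
  rewrite (surjective_pairing a) (surjective_pairing b).
  rewrite xpair_eqE -[_ == b.1]subr_eq0 -[_ == b.2]subr_eq0.
  have m0 (x y : R) : s * (y - x) = t * (y - x) -> x - y == 0.
    move=> /eqP; rewrite -subr_eq0 -mulrBl mulf_eq0 (negPf st) /=.
    by rewrite -opprB oppr_eq0.
  by rewrite (m0 _ _ e1) (m0 _ _ e2).
- by rewrite /along !mul0r !addr0 -surjective_pairing.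
- by rewrite /along !mul1r !subrKC -surjective_pairing.
Qed.

Lemma cross_along a b c d t :
  cross c d (along a b t) = (1 - t) * cross c d a + t * cross c d b.
Proof. by rewrite /cross /along /=; ring. Qed.

Lemma cross_segment a b z : segment a b z -> cross a b z = 0.
Proof. by move=> [t _ <-]; rewrite /cross /along /=; ring. Qed.

(** An inner point of a segment stays strictly on the side on which the ends
    lie weakly, provided that one of them lies strictly on it. *)
Lemma combination_gt0 (t x y : R) : 0 < t -> t < 1 ->
  0 <= x -> 0 <= y -> 0 < x + y -> 0 < (1 - t) * x + t * y.
Proof.
move=> t0 t1 x0 y0 xy; have t'0 : 0 < 1 - t by rewrite subr_gt0.
have [x_gt0|x_le0] := ltrP 0 x.
  by rewrite ltr_pwDl ?mulr_gt0 ?mulr_ge0 // ltW.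
by rewrite ltr_wpDl ?mulr_gt0 ?mulr_ge0 ?(ltW t'0) //; lra.
Qed.

(** The function [cross c d] is affine along [a b] and vanishes on the segment
    [c d], so a common point would make a combination of two numbers of the
    same sign vanish. *)
Lemma noncrossingP a b c d : noncrossing a b c d ->
  (segment a b `\` [set a; b]) `&` segment c d = set0.
Proof.
move=> nc; apply/seteqP; split=> // z [[[t /= t01 zt] zab] zcd].
have z_ab : cross a b z = 0 by apply: cross_segment; exists t.
have := cross_segment zcd; rewrite -zt cross_along => z_cd.
move: zcd z_ab => [s /= s01 <-]; rewrite cross_along => z_ab.
move: t01 s01; rewrite !in_itv /= => /andP[t0 t1] /andP[s0 s1].
(* A point of [a b] other than its ends has a parameter strictly inside. *)
have t_neq0 : t != 0.
  apply: contra_not_neq zab => t_eq0; left.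
  by rewrite -zt t_eq0 /along !mul0r !addr0 -surjective_pairing.
have t_neq1 : t != 1.
  apply: contra_not_neq zab => t_eq1; right.
  by rewrite -zt t_eq1 /along !mul1r !subrKC -surjective_pairing.
have {}t0 : 0 < t by rewrite lt0r t_neq0.
have {}t1 : t < 1 by rewrite lt_neqAle t_neq1.
case/or3P: nc => [/and3P[p q pq]|/and3P[p q pq]|pq].
- have := combination_gt0 t0 t1 p q pq.
  by rewrite z_cd ltxx.
- have := @combination_gt0 t (- cross c d a) (- cross c d b) t0 t1.
  rewrite !oppr_ge0 -opprD oppr_gt0 !mulrN -opprD z_cd oppr0 ltxx.
  by move/(_ p q pq).
- (* Multiplied by its value at [c], the affine function [cross a b] becomes
     positive at both [c] and [d], whatever their common sign was. *)
  have : 0 < (1 - s) * cross a b c ^+ 2 + s * (cross a b c * cross a b d).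
    have [->|s_neq0] := eqVneq s 0.
      rewrite subr0 mul1r mul0r addr0 exprn_even_gt0 //=.
      by apply: contraTneq pq => ->; rewrite mul0r ltxx.
    apply: ltr_wpDl; first by rewrite mulr_ge0 ?sqr_ge0 ?subr_ge0.
    by apply: mulr_gt0 => //; rewrite lt0r s_neq0.
  suff -> : (1 - s) * cross a b c ^+ 2 + s * (cross a b c * cross a b d) = 0.
    by rewrite ltxx.
  by rewrite -[RHS](mulr0 (cross a b c)) -z_ab; ring.
Qed.

End Segment.

(** * Straight-line drawings *)

Section StraightLineDrawing.
Local Open Scope classical_set_scope.
Local Open Scope ring_scope.

(** Listing each edge in only one direction suffices, because segments are
    symmetric.  That no vertex lies inside an edge follows from the absence of
    crossings, since every vertex is an end of some edge; hence the hypothesis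
    that there is no isolated vertex. *)
Lemma planar_of_straight_lines (R : realType) (G : sgraph)
    (E : seq (G * G)) (p : G -> BinNums.Z * BinNums.Z) :
  injective p ->
  (forall u, exists v : G, adj u v) ->
  (forall u v : G, adj u v -> ((u, v) \in E) || ((v, u) \in E)) ->
  {in E &, forall e f, e != f ->
     noncrossing (p e.1) (p e.2) (p f.1) (p f.2)} ->
  planar R G.
Proof.
move=> p_inj nbr E_adj E_nc; pose P v := point R (p v).
have P_inj : injective P by move=> u v /point_inj/p_inj.
have listed u v : adj u v -> exists2 e, e \in E &
    [/\ [set u; v]%SET = [set e.1; e.2]%SET,
        segment (P u) (P v) = segment (P e.1) (P e.2) &
        [set P u; P v] = [set P e.1; P e.2]].
  case/E_adj/orP=> uvE; first by exists (u, v).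
  exists (v, u) => //.
  by split; [exact: finset.setUC|exact: segmentC|exact: setUC].
have disj u v x y : adj u v -> adj x y ->
    [set u; v]%SET != [set x; y]%SET ->
    (segment (P u) (P v) `\` [set P u; P v]) `&` segment (P x) (P y) = set0.
  move=> /listed[e eE [-> -> ->]] /listed[f fE [-> -> _]] ef.
  apply: noncrossingP; rewrite noncrossing_point; apply: E_nc => //.
  by apply: contraNneq ef => ->.
exists P, (fun u v => segment (P u) (P v)); split=> //.
- by move=> u v _; exact: segmentC.
- move=> u v uv; apply: is_arc_segment; apply/eqP => /P_inj uv_eq.
  by rewrite uv_eq adj_irrefl in uv.
- (* An edge [wx] at [w] either has the ends of [uv], and then [w] is one of
     them, or is disjoint from the interior of [uv]. *)
  move=> u v w uv w_uv; have [x wx] := nbr w.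
  have [uv_wx|/disj-/(_ uv wx)] := eqVneq [set u; v]%SET [set w; x]%SET.
    have: w \in [set u; v]%SET by rewrite uv_wx !inE eqxx.
    by rewrite !inE => /orP[] /eqP wE; case: w_uv => _; apply; [left|right];
       rewrite wE.
  by apply/eqP/set0P; exists (P w); split=> //; exact: segment_left.
Qed.

End StraightLineDrawing.

(** * Counting along explicit lists *)

Lemma card_pred_count (T : finType) (P : pred T) (s : seq T) :
  uniq s -> (forall u, P u -> u \in s) -> #|[pred u | P u]| = count P s.
Proof.
move=> s_uniq P_s; rewrite -size_filter -(card_uniqP (filter_uniq _ s_uniq)).
apply: eq_card => u; rewrite mem_filter inE /=.
by case: (boolP (P u)) => //= /P_s ->.
Qed.

Lemma count_leq_card (T : finType) (P : pred T) (s : seq T) :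
  uniq s -> count P s <= #|[pred u | P u]|.
Proof.
move=> s_uniq; rewrite -size_filter -(card_uniqP (filter_uniq _ s_uniq)).
apply: subset_leq_card; apply/fintype.subsetP => u.
by rewrite mem_filter => /andP[].
Qed.

(** * The graph *)

Inductive node :=
  | Hub of bool & bool
  | Single of bool & 'I_7
  | Twin of bool & 'I_7 & bool
  | Link of bool & 'I_7.

Definition node_code (v : node) :
    bool * bool + bool * 'I_7 + bool * 'I_7 * bool + bool * 'I_7 :=
  match v with
  | Hub s t => inl (inl (inl (s, t)))
  | Single s i => inl (inl (inr (s, i)))
  | Twin s i t => inl (inr (s, i, t))
  | Link s i => inr (s, i)
  end.

Definition node_decode c : node :=
  match c with
  | inl (inl (inl (s, t))) => Hub s t
  | inl (inl (inr (s, i))) => Single s i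
  | inl (inr (s, i, t)) => Twin s i t
  | inr (s, i) => Link s i
  end.

Lemma node_codeK : cancel node_code node_decode.
Proof. by case. Qed.

HB.instance Definition _ := Finite.copy node (can_type node_codeK).

(** Each edge is listed from one of its ends only, which serves both the
    drawing and the explicit orientation. *)
Definition edge (u v : node) : bool :=
  match u, v with
  | Hub s _, Hub s' _ => ~~ s && s'
  | Hub s _, (Single s' _ | Twin s' _ _) => s == s'
  | Link s i, Twin s' j _ => (s == s') && (i == j)
  | _, _ => false
  end.

Definition joined : rel node := fun u v => edge u v || edge v u.

Lemma joined_sym : symmetric joined.
Proof. by move=> u v; rewrite /joined orbC. Qed.

Lemma joined_irrefl : irreflexive joined.
Proof. by case=> // -[]. Qed.

Lemma node_gt0 : 0 < #|{: node}|.
Proof. by apply/card_gt0P; exists (Hub false false). Qed.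

Definition hub_graph : sgraph := SGraph joined_sym joined_irrefl node_gt0.

Lemma hub_graph_bipartite : bipartite hub_graph.
Proof.
exists (fun v : node => match v with
  Hub s _ | Link s _ => s | Single s _ | Twin s _ _ => ~~ s end).
move=> u v; rewrite /= /joined.
by move: u v => [s t|s i|s i t|s i] [s' t'|s' j|s' j t'|s' j] //=;
   move: s s' => [] [].
Qed.

Definition copies : seq 'I_7 :=
  [:: @Ordinal 7 0 isT; @Ordinal 7 1 isT; @Ordinal 7 2 isT; @Ordinal 7 3 isT;
      @Ordinal 7 4 isT; @Ordinal 7 5 isT; @Ordinal 7 6 isT].

Definition bools := [:: false; true].

(** An explicit list of the vertices, so that finite checks over the graph are
    computations. *)
Definition nodes : seq node :=
  [seq Hub s t | s <- bools, t <- bools] ++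
  [seq Single s i | s <- bools, i <- copies] ++
  [seq Twin si.1 si.2 t
     | si <- [seq (s, i) | s <- bools, i <- copies], t <- bools] ++
  [seq Link s i | s <- bools, i <- copies].

Lemma nodes_uniq : uniq nodes.
Proof. by vm_compute. Qed.

Lemma mem_nodes v : v \in nodes.
Proof.
case: v => [[] []|[] [i]|[] [i +] []|[] [i]]; try by vm_compute.
all: by move: i => [|[|[|[|[|[|[|i]]]]]]] lt_i7; vm_compute.
Qed.

Lemma nodesP (P : pred node) : all P nodes -> forall v, P v.
Proof. by move=> /allP P_all v; apply/P_all/mem_nodes. Qed.

Lemma hub_graph_min_degree : is_min_degree hub_graph 2.
Proof.
have degE (v : hub_graph) : degree v = count (joined v) nodes.
  exact: (card_pred_count nodes_uniq (fun u _ => mem_nodes u)).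
split; first by exists (Link false ord0); rewrite degE; vm_compute.
move=> _ [v <-]; rewrite degE.
by apply: (nodesP (P := fun v => 2 <= count (joined v) nodes)); vm_compute.
Qed.

(** * No proper 3-orientation *)

Section LowerBound.
Variable o : rel hub_graph.
Hypothesis o_or : orientation o.

Lemma arc_joined (u v : node) : o u v -> joined u v.
Proof. exact: o_or.1. Qed.

Lemma indegree_single s i :
  indegree o (Single s i) =
    o (Hub s false) (Single s i) + o (Hub s true) (Single s i).
Proof.
rewrite /indegree (@card_pred_count hub_graph _
  [:: Hub s false; Hub s true]) /= ?addn0 //.
  by case: s.
move=> u /arc_joined; rewrite /joined /=.
by case: u => //= s' [] /[!orbF] /eqP ->; rewrite !inE eqxx ?orbT.
Qed.

Lemma indegree_link s i :
  indegree o (Link s i) =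
    o (Twin s i false) (Link s i) + o (Twin s i true) (Link s i).
Proof.
rewrite /indegree (@card_pred_count hub_graph _
  [:: Twin s i false; Twin s i true]) /= ?addn0 //.
  by rewrite !inE; case: s; rewrite andbT; apply/eqP; case.
move=> u /arc_joined; rewrite /joined /=.
by case: u => //= s' j [] /andP[/eqP -> /eqP ->]; rewrite !inE eqxx ?orbT.
Qed.

Lemma indegree_twin s i t :
  indegree o (Twin s i t) =
    o (Hub s false) (Twin s i t) + o (Hub s true) (Twin s i t)
      + o (Link s i) (Twin s i t).
Proof.
rewrite /indegree (@card_pred_count hub_graph _
  [:: Hub s false; Hub s true; Link s i]) /=.
- by rewrite addn0 addnA.
- by case: s.
move=> u /arc_joined; rewrite /joined /=.
by case: u => [s' []|s' j|s' j t'|s' j] //= /[!orbF] /eqP ->;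
   rewrite !inE eqxx ?orbT.
Qed.

Definition copy_of (v : node) : option 'I_7 :=
  match v with
  | Hub _ _ => None
  | Single _ i | Twin _ i _ | Link _ i => Some i
  end.

(** If each of the seven copies sent an arc to one of the two hubs, choosing
    one such arc per copy would inject ['I_7] into the at most 3 + 3 arcs that
    enter these hubs. *)
Lemma untouched_copy s :
  (forall v, indegree o v <= 3) ->
  exists i, forall v t, copy_of v = Some i -> ~~ o v (Hub s t).
Proof.
move=> le3; pose touched i (vt : node * bool) :=
  (copy_of vt.1 == Some i) && o vt.1 (Hub s vt.2).
case: (boolP [exists i, forall vt, ~~ touched i vt]).
  move=> /existsP[i /forallP Hi]; exists i => v t vi.
  by have := Hi (v, t); rewrite /touched /= vi eqxx.
rewrite negb_exists => /forallP all_touched.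
have {}all_touched i : exists vt, touched i vt.
  have := all_touched i; rewrite negb_forall => /existsP[vt].
  by rewrite negbK; exists vt.
pose f i := xchoose (all_touched i).
have fP i : touched i (f i) by exact: xchooseP.
have f_inj : injective f.
  move=> i j fij; have /andP[/eqP + _] := fP i; rewrite fij.
  by have /andP[/eqP -> _] := fP j => -[].
have : #|codom f| <= #|[pred vt : node * bool | o vt.1 (Hub s vt.2)]|.
  apply: subset_leq_card; apply/fintype.subsetP => _ /codomP[i ->].
  by have /andP[] := fP i.
rewrite card_codom // card_ord.
have -> : #|[pred vt : node * bool | o vt.1 (Hub s vt.2)]|
          = indegree o (Hub s true) + indegree o (Hub s false).
  rewrite -sum1_card
    -(pair_big_dep xpredT (fun v t => o v (Hub s t)) (fun _ _ => 1)) /=.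
  rewrite (exchange_big_dep xpredT) //= big_bool /=.
  by rewrite !sum1_card.
by have := le3 (Hub s true); have := le3 (Hub s false); lia.
Qed.

(** In an untouched gadget, the single has indegree 2 and some twin has
    indegree 3; both are adjacent to the hub, which excludes 2 and 3. *)
Lemma hub_indegree_le1 s t :
  (forall v, indegree o v <= 3) -> Defs.proper o -> indegree o (Hub s t) <= 1.
Proof.
move=> le3 o_proper; have [i untouched] := untouched_copy s le3.
have from_hub t' (v : node) : copy_of v = Some i -> joined (Hub s t') v ->
    o (Hub s t') v.
  by move=> vi /o_or.2; rewrite (negPf (untouched _ _ vi)) addbF.
have single2 : indegree o (Single s i) = 2.
  by rewrite indegree_single !from_hub //= /joined /= eqxx.
have twin t' : indegree o (Twin s i t') = 2 + o (Link s i) (Twin s i t').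
  by rewrite indegree_twin !from_hub //= /joined /= eqxx.
have hub_ne v : joined (Hub s t) v -> indegree o (Hub s t) <> indegree o v.
  exact: o_proper.
have hub_ne2 : indegree o (Hub s t) <> 2.
  by rewrite -single2; apply: hub_ne; rewrite /joined /= eqxx.
(* Otherwise both twins point to the link, and the link and the twins all
   have indegree 2. *)
have [t' twin3] : exists t', o (Link s i) (Twin s i t').
  apply: contrapT => no3.
  have link_tw t' : joined (Link s i) (Twin s i t').
    by rewrite /joined /= !eqxx.
  have out t' : o (Link s i) (Twin s i t') = false.
    by apply/negP => ?; apply: no3; exists t'.
  have into t' : o (Twin s i t') (Link s i).
    by have := o_or.2 _ _ (link_tw t'); rewrite out.
  apply: (o_proper _ _ (link_tw true)).
  by rewrite indegree_link !into twin out.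
have hub_ne3 : indegree o (Hub s t) <> 3.
  have := hub_ne (Twin s i t'); rewrite twin twin3; apply.
  by rewrite /joined /= eqxx.
by have := le3 (Hub s t); lia.
Qed.

(** Opposite ends of a hub edge have distinct indegrees in {0, 1}, so the four
    hubs receive at most 2 arcs in all, fewer than the 4 arcs of their cycle. *)
Lemma no_proper_3_orientation :
  (forall v, indegree o v <= 3) -> ~ Defs.proper o.
Proof.
move=> le3 o_proper; have le1 s t := hub_indegree_le1 s t le3 o_proper.
have opp t t' : o (Hub false t) (Hub true t') (+) o (Hub true t') (Hub false t).
  exact: o_or.2.
have ne t t' : indegree o (Hub false t) <> indegree o (Hub true t').
  exact: o_proper.
have from_opposite s t : o (Hub (~~ s) false) (Hub s t)
    + o (Hub (~~ s) true) (Hub s t) <= indegree o (Hub s t).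
  have := @count_leq_card hub_graph (o^~ (Hub s t))
    [:: Hub (~~ s) false; Hub (~~ s) true].
  by rewrite /= addn0; apply; case: s.
move: (from_opposite false false) (from_opposite false true).
move: (from_opposite true false) (from_opposite true true) => /=.
move: (opp false false) (opp false true) (opp true false) (opp true true).
move: (ne false false) (ne true true).
move: (le1 false false) (le1 false true) (le1 true false) (le1 true true).
do 8 case: (o _ _) => //=; lia.
Qed.
End LowerBound.

(** * A proper 4-orientation *)

(** A hub [Hub true t] receives two arcs from the hubs [Hub false _]; two
    sources among its singles raise its indegree to 4, away from the values 0,
    2 and 3 of its neighbours. *)
Definition flipped (v : node) : bool :=
  if v is Single true i then i < 2 else false.

Definition orient : rel node := fun u v =>
  if flipped u || flipped v then edge v u else edge u v.

Definition orient_indegree (v : node) : nat :=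
  match v with
  | Hub s _ => if s then 4 else 0
  | Single s i => if flipped (Single s i) then 0 else 2
  | Twin _ _ _ => 3
  | Link _ _ => 0
  end.

Lemma orient_indegreeE (v : hub_graph) :
  indegree (orient : rel hub_graph) v = orient_indegree v.
Proof.
rewrite /indegree (@card_pred_count hub_graph _ nodes) ?nodes_uniq //; last first.
  by move=> u _; exact: mem_nodes.
apply/eqP; move: v; apply: nodesP; by vm_compute.
Qed.

Lemma orient_orientation : orientation (orient : rel hub_graph).
Proof.
have edge_asym u v : edge u v -> ~~ edge v u.
  by move: u v => [s t|s i|s i t|s i] [s' t'|s' j|s' j t'|s' j] //=;
     move: s s' => [] [].
split=> u v; rewrite /= /joined /orient.
  by case: ifP => _ ->; rewrite ?orbT.
rewrite [flipped v || _]orbC.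
by case: ifP => _ /orP[] uv; rewrite uv (negPf (edge_asym _ _ uv)) ?addbT.
Qed.

Lemma orient_proper : Defs.proper (orient : rel hub_graph).
Proof.
move=> u v; rewrite !orient_indegreeE /= /joined.
by move: u v => [[] t|[] i|s i t|s i] [[] t'|[] j|s' j t'|s' j] //=; case: ifP.
Qed.

Lemma hub_graph_proper_orientation_number :
  is_proper_orientation_number hub_graph 4.
Proof.
split.
  exists orient; split; last exact: orient_proper.
  split; first exact: orient_orientation.
  move=> v; rewrite orient_indegreeE.
  by case: v => [[] ?|s i|s i t|s i] //=; case: ifP.
move=> j [sigma [[is_or le_j] o_proper]]; rewrite leqNgt; apply/negP => lt_j4.
apply: (no_proper_3_orientation is_or _ o_proper) => v.
exact: leq_trans (le_j v) lt_j4.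
Qed.

(** * The planar drawing *)

(** The gadgets of the horizontal hubs go up the vertical axis at heights 1 to
    28, below the hub at height 100; those of the vertical hubs go along the
    horizontal axis from abscissa 41 on, beyond the hub at abscissa 40.  The
    offset [w] moves a link off the axis of its gadget, so that its edges are
    not collinear with each other or with those of other gadgets; the radii 40
    and 100 are large enough for the link to stay in the thin quadrilateral
    between its twins and their hubs. *)
Definition place (s : bool) (h w : nat) : BinNums.Z * BinNums.Z :=
  let z := BinInt.Z.of_nat in
  if s then (z (40 + h), z w) else (z w, z h).

Definition position (v : node) : BinNums.Z * BinNums.Z :=
  match v with
  | Hub s t =>
      let r := BinInt.Z.of_nat (if s then 100 else 40) in
      let c := if t then r else BinInt.Z.opp r in
      if s then (BinNums.Z0, c) else (c, BinNums.Z0)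
  | Single s i => place s (4 * i + 1) 0
  | Twin s i t => place s (4 * i + if t then 4 else 2) 0
  | Link s i => place s (4 * i + 3) 1
  end.

Definition edges : seq (node * node) :=
  [seq e <- [seq (u, v) | u <- nodes, v <- nodes] | edge e.1 e.2].

Lemma position_inj : injective position.
Proof.
have inj_on : all (fun u => all (fun v =>
    (position u == position v) ==> (u == v)) nodes) nodes by vm_compute.
move=> u v puv; have /nodesP/(_ v) := nodesP inj_on u.
by rewrite puv eqxx => /eqP.
Qed.

Lemma edges_noncrossing : all (fun e => all (fun f => (e == f) ||
    noncrossing (position e.1) (position e.2) (position f.1) (position f.2))
  edges) edges.
Proof. by vm_compute. Qed.

Lemma hub_graph_planar (R : realType) : planar R hub_graph.
Proof.
have listed u v : edge u v -> (u, v) \in edges.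
  move=> uv; rewrite mem_filter; apply/andP; split=> //.
  exact: (allpairs_f pair (mem_nodes u) (mem_nodes v)).
apply: (@planar_of_straight_lines R hub_graph edges position).
- exact: position_inj.
- case=> [s t|s i|s i t|s i].
  + by exists (Hub (~~ s) false); rewrite /= /joined /=; case: s.
  + by exists (Hub s false); rewrite /= /joined /= eqxx.
  + by exists (Hub s false); rewrite /= /joined /= eqxx.
  + by exists (Twin s i false); rewrite /= /joined /= !eqxx.
- by move=> u v /= /orP[] /listed ->; rewrite ?orbT.
- move=> e f eE fE ef; have /allP/(_ e eE)/allP/(_ f fE) := edges_noncrossing.
  by rewrite (negPf ef).
Qed.

Theorem theorem6 (R : realType) :
  exists G : sgraph,
    [/\ bipartite G, planar R G,
        is_min_degree G 2 & is_proper_orientation_number G 4].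
Proof.
exists hub_graph; split.
- exact: hub_graph_bipartite.
- exact: hub_graph_planar.
- exact: hub_graph_min_degree.
- exact: hub_graph_proper_orientation_number.
Qed.
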